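(* For every integer $n\ge -1$, we have $|\Sigma_n|=G_{n+1}$, where $\Sigma_n$ is the set of level-$n$ vertices of the state graph $\Sigma$ and $G_m=F_{2m+1}$ are the odd-indexed Fibonacci numbers.
   Context: The Fibonacci numbers are $F_0=0$, $F_1=1$, $F_n=F_{n-1}+F_{n-2}$ for $n\ge 2$; set $G_n:=F_{2n+1}$ for $n\ge 0$. For a $0$-$1$ sequence $\mathbf{a}=a_1a_2\dots a_m$ let $\mathrm{supp}(\mathbf{a})=\{i: a_i=1\}$. The vertex sets $\Sigma_i$, $i\ge -1$, of the graph $\Sigma$ are defined recursively; each element of $\Sigma_i$ is a set of $0$-$1$ sequences of length $i+2$. The set $\Sigma_{-1}$ is a singleton whose only element is the set $\{0,1\}$ of the two sequences of length one. Given $\Sigma_i$, for each $N\in\Sigma_i$ and each $\mathbf{a}=a_1\dots a_{i+2}\in N$ let $M=M(N,\mathbf{a})$ be the set of all $0$-$1$ sequences $\mathbf{b}=b_1b_2\dots b_{i+3}$ satisfying: (A) if $b_{i+3}=1$, then $\mathrm{supp}(\mathbf{a})\subseteq\mathrm{supp}(\mathbf{b})$; (B) if $b_s=1$ for some $s<i+3$ and $a_t=1$ for some $t<s$, then $b_t=a_s=1$; (C) $b_1b_2\dots b_{i+2}\in N$. Then $\Sigma_{i+1}$ is the set of all $M(N,\mathbf{a})$ with $N\in\Sigma_i$, $\mathbf{a}\in N$ (as a set, so equal collections are identified). *)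

(* Defs.v *)
From mathcomp Require Import all_boot all_order all_algebra.

Set Implicit Arguments.
Unset Strict Implicit.
Unset Printing Implicit Defensive.

Fixpoint fib (n : nat) : nat :=
  match n with
  | 0 => 0
  | 1 => 1
  | (m.+1 as p).+1 => fib p + fib m
  end.

Definition G (n : nat) : nat := fib (2 * n).+1.

(* Positions in a sequence of length m are numbered 0, ..., m - 1 instead of
   1, ..., m; below, [a] has length m = i + 2 and [b] has length m + 1. *)

Definition supp (m : nat) (a : m.-tuple bool) : {set 'I_m} :=
  [set i | tnth a i].

Definition widen (m : nat) (i : 'I_m) : 'I_m.+1 := widen_ord (leqnSn m) i.

Definition init (m : nat) (b : m.+1.-tuple bool) : m.-tuple bool :=
  [tuple tnth b (widen i) | i < m].

Definition condA (m : nat) (a : m.-tuple bool) (b : m.+1.-tuple bool) : bool :=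
  tnth b ord_max ==> ([set widen i | i in supp a] \subset supp b).

Definition condB (m : nat) (a : m.-tuple bool) (b : m.+1.-tuple bool) : bool :=
  [forall s : 'I_m, forall t : 'I_m,
     [&& tnth b (widen s), t < s & tnth a t]
       ==> (tnth b (widen t) && tnth a s)].

Definition condC (m : nat) (N : {set m.-tuple bool}) (b : m.+1.-tuple bool) :
  bool := init b \in N.

Definition M (m : nat) (N : {set m.-tuple bool}) (a : m.-tuple bool) :
  {set m.+1.-tuple bool} :=
  [set b | [&& condA a b, condB a b & condC N b]].

(* [Sigma_rec k] is the level of index k - 1, whose elements are sets of
   sequences of length (k - 1) + 2 = k + 1. *)
Fixpoint Sigma_rec (k : nat) : {set {set k.+1.-tuple bool}} :=
  match k with
  | 0 => [set [set [tuple false]; [tuple true]]]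
  | k'.+1 => [set M N a | N in Sigma_rec k', a in N]
  end.

(* Meaningful for n >= -1 only: the absolute value is then n + 1 itself. *)
Definition Sigma (n : int) : {set {set (absz (n + 1)%R).+1.-tuple bool}} :=
  Sigma_rec (absz (n + 1)%R).

(* Main.v *)
From HB Require Import structures.
Require Import Defs.
From mathcomp Require Import all_boot all_order all_algebra.

(** Every vertex of the state graph is coded by a word over the letters [Start],
    [Link], [Gap].  Each [Start] opens a block reaching up to the next [Start];
    the vertex consists of the sequences that vanish on the gaps and whose
    support in each block is an initial segment of the positions that are not
    gaps.  Choosing [a] replaces all blocks from the first [1] of [a] on by a
    single block whose non-gap positions are those of [supp a] and the new
    position.  The words reached in this way are exactly those that begin with
    [Start] and in which every run of gaps is followed by [Link]; distinct words
    code distinct vertices, and such words are counted by odd-indexed Fibonacci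
    numbers. *)

(** * Words and the sequences they accept *)

Inductive letter := Start | Link | Gap.

Definition letter_code (l : letter) : option bool :=
  match l with Start => Some true | Link => Some false | Gap => None end.

Definition letter_decode (o : option bool) : letter :=
  match o with Some true => Start | Some false => Link | None => Gap end.

Lemma letter_codeK : cancel letter_code letter_decode.
Proof. by case. Qed.

HB.instance Definition _ := Equality.copy letter (can_type letter_codeK).

(* [f] tells whether the last non-gap position carries a [1]; letters or bits in
   excess are ignored. *)
Fixpoint accepts (f : bool) (w : seq letter) (b : seq bool) : bool :=
  match w, b with
  | Start :: w', x :: b' => accepts x w' b'
  | Link :: w', x :: b' => (x ==> f) && accepts x w' b'
  | Gap :: w', x :: b' => ~~ x && accepts f w' b'
  | _, _ => true
  end.

Definition mark (x : bool) : letter := if x then Link else Gap.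

Fixpoint fuse (w : seq letter) (a : seq bool) : seq letter :=
  match w, a with
  | l :: w', x :: a' => if x then Start :: map mark a' else l :: fuse w' a'
  | _, _ => [::]
  end.

(* [p] tells whether the previous letter is a gap. *)
Fixpoint wf (p : bool) (w : seq letter) : bool :=
  match w with
  | [::] => ~~ p
  | Start :: w' => ~~ p && wf false w'
  | Link :: w' => wf false w'
  | Gap :: w' => wf true w'
  end.

(* Conditions (A) and (B) together, for [a] extended by a final [1]. *)
Definition compat (a b : seq bool) : Prop :=
  forall t s, t < s -> nth false b s -> nth false a t ->
    nth false b t && nth false a s.

Lemma accepts_nseq0 f w n : accepts f w (nseq n false).
Proof. by elim: w f n => [|[] w IH] f [|n] //=; rewrite IH. Qed.

Lemma accepts_nseq_Start f n a : accepts f (nseq n Start) a.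
Proof. by elim: n f a => [|n IH] f [|x a] //=; exact: IH. Qed.

Lemma accepts_rcons_Start f w b :
  accepts f (rcons w Start) b = accepts f w b.
Proof.
by elim: w f b => [|[] w IH] f [|x b] //=; rewrite IH.
Qed.

Lemma accepts_take n f w b :
  size w <= n -> accepts f w (take n b) = accepts f w b.
Proof. by elim: w n f b => [|[] w IH] [|n] f [|x b] //= H; rewrite IH. Qed.

(** On the input [1 0 ... 0], a leading [Start] accepts under both flags, [Link] only under [true],
    [Gap] under neither, so the first letter can be read off. A suitable first bit then passes any
    flag [f] on to the tail. *)
Lemma accepts_inj w w' : size w = size w' ->
    (forall f b, size b = size w -> accepts f w b = accepts f w' b) ->
  w = w'.
Proof.
elim: w w' => [|l w IH] [|l' w'] // [sz] H.
have H0 f : accepts f (l :: w) (true :: nseq (size w) false) =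
            accepts f (l' :: w') (true :: nseq (size w) false).
  by apply: H; rewrite /= size_nseq.
have Ht := H0 true; have {H0} Hf := H0 false.
have ll' : l = l'.
  by case: l l' Ht Hf {H} => [] []; rewrite /= ?accepts_nseq0.
move: H; rewrite -ll' => H; congr (_ :: _); apply: IH => // f b sb.
case: l {Ht Hf ll'} H => H.
- by apply: (H true (f :: b)); rewrite /= sb.
- by have := H true (f :: b); rewrite /= sb implybT /=; apply.
- by have := H f (false :: b); rewrite /= sb /=; apply.
Qed.

Lemma compat_cons x a y b :
  compat (x :: a) (y :: b) <->
  (x -> forall s, nth false b s -> y && nth false a s) /\ compat a b.
Proof.
split=> [H|[H0 H] [|t] [|s] //= ts bs xt].
- split=> [hx s bs|t s ts bs ta]; first exact: (H 0 s.+1).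
  exact: (H t.+1 s.+1).
- exact: H0.
- exact: H.
Qed.

(** By [compat_cons], the right-hand side is [compat (true :: a) (g :: b)]: the flag [g] is the bit
    of [b] at the first 1 of the fused sequence. *)
Lemma accepts_markP g a b : size a = size b ->
  accepts g (map mark a) b <->
  (forall s, nth false b s -> g && nth false a s) /\ compat a b.
Proof.
elim: a g b => [|x a IH] g [|y b] //= => [_|[sz]].
  by split=> // _; split=> [s|t s _]; rewrite nth_nil.
have [IH1 IH2] := compat_cons x a y b.
case: x IH1 IH2 => /= c1 c2.
- split=> [/andP[/implyP yg /(IH _ _ sz)[H1 H2]]|[H1 /c1[H2 H3]]].
    split; last by apply: c2.
    case=> [|s] /= bs; first by rewrite yg.
    by have /andP[/yg -> ->] := H1 _ bs.
  apply/andP; split; first by apply/implyP=> hy; have := H1 0 hy; rewrite andbT.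
  by apply/(IH _ _ sz); split=> // s; apply: H2.
- split=> [/andP[ny /(IH _ _ sz)[H1 H2]]|[H1 /c1[_ H3]]].
    split; last by apply: c2.
    by case=> [|s] /= bs; [rewrite bs in ny | apply: H1].
  apply/andP; split; first by apply/negP=> hy; have := H1 0 hy; rewrite andbF.
  by apply/(IH _ _ sz); split=> // s bs; apply: (H1 s.+1).
Qed.

(** An initial segment of [supp a] meets each block of [w] in an initial segment of what [a] has
    there. The hypothesis on the three flags is the invariant that carries this through the
    induction. *)
Lemma accepts_mark_sub (fa g f : bool) w a b :
    size w = size a -> size a = size b -> (g && fa -> f) ->
  accepts fa w a -> accepts g (map mark a) b -> accepts f w b.
Proof.
elim: w fa g f a b => [|l w IH] fa g f [|x a] [|y b] //= [sw] [sa] gf.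
case: l => /=; case: x => //=.
- by move=> wa /andP[_]; apply: IH wa => //; case: (y).
- by move=> wa /andP[/negbTE -> ]; apply: IH wa => //; rewrite andbF.
- move=> /andP[hf wa] /andP[/implyP yg H]; apply/andP; split.
    by apply/implyP=> /yg hg; apply: gf; rewrite hg hf.
  by apply: IH wa H => //; case: (y).
- by move=> wa /andP[/negbTE -> H] /=; apply: IH wa H => //; rewrite andbF.
- by move=> wa /andP[/negbTE -> H] /=; apply: IH wa H.
Qed.

(** Before the first 1 of [a], compatibility demands nothing and both words have the same letters;
    from there on, the new block expresses compatibility and implies acceptance by [w]. *)
Lemma accepts_fuse f w a b :
    size w = size a -> size a = size b -> accepts false w a ->
  accepts f (fuse w a) b <-> compat a b /\ accepts f w b.
Proof.
elim: w f a b => [|l w IH] f [|x a] [|y b] //=.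
  by move=> *; split=> // _; split=> // t s _; rewrite nth_nil.
move=> [sw] [sa]; have [c1 c2] := compat_cons x a y b.
case: x c1 c2 => c1 c2; last first.
  have cE : compat (false :: a) (y :: b) <-> compat a b.
    by split=> [/c1[]|H] //; apply: c2.
  case: l => /=.
  - by move=> wa; split=> [/IH[] // /cE|[/cE H1 H2]] //; apply/IH.
  - move=> wa; split=> [/andP[-> /IH[] // H1 H2]|[/cE H1 /andP[-> H2]]].
      by split; first apply/cE.
    by apply/IH.
  - move=> wa; split=> [/andP[-> /IH[] // H1 H2]|[/cE H1 /andP[-> H2]]].
      by split; first apply/cE.
    by apply/IH.
(* Only zeros precede this 1 and the initial flag is [false], so the letter here is [Start]. *)
case: l => //= wa; split=> [H|[/c1[H1 H2] _]]; last first.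
  by apply/accepts_markP=> //; split=> // s; apply: H1.
split; last by apply: accepts_mark_sub wa H => //; rewrite andbT.
by apply: c2; have /accepts_markP[] := H.
Qed.

Lemma size_fuse w a : size w = size a -> size (fuse w a) = size w.
Proof.
elim: w a => [|l w IH] [|x a] //= [sz].
by case: x => /=; rewrite ?size_map ?IH ?sz.
Qed.

(** * Fusion and well-formed words *)

Lemma wf_mark p a : wf p (map mark (rcons a true)).
Proof. by elim: a p => [|[] a IH] p /=. Qed.

Lemma wf_nseq_Start n : wf false (nseq n Start).
Proof. by elim: n. Qed.

Lemma wf_fuse p w a : size w = size a -> accepts false w a -> wf p w ->
  wf p (fuse (rcons w Start) (rcons a true)).
Proof.
elim: w p a => [|l w IH] p [|x a] //=; first by rewrite andbT.
move=> [sz]; case: x; case: l => //=.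
- by move=> _ /andP[-> _]; apply: wf_mark.
- by move=> wa /andP[-> ?]; apply: IH.
- by move=> wa ?; apply: IH.
- by move=> wa ?; apply: IH.
Qed.

Lemma map_markE w : Start \notin w -> map mark (map (predC1 Gap) w) = w.
Proof. by elim: w => //= [[]] w IH; rewrite inE //= => /IH ->. Qed.

(** Well-formedness excludes a final gap, so a nonempty word without [Start] ends in [Link], the
    mark of the appended 1. *)
Lemma mark_rcons w p : Start \notin w -> wf p w ->
  w = [::] \/ exists a, w = map mark (rcons a true).
Proof.
case/lastP: w => [|w l]; first by left.
move=> nS wfw; right; exists (map (predC1 Gap) w).
move: nS; rewrite mem_rcons inE negb_or map_rcons => /andP[lS nS].
rewrite map_markE //; congr rcons.
case: l lS wfw => // _; have -> : wf p (rcons w Gap) = false.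
  by elim: w p {nS} => [|[] w IH] p //=; rewrite IH ?andbF.
by [].
Qed.

(* Fusion may start from the word in which the last block is cut into
   singletons, as such blocks impose no condition on [a]. *)
Lemma fuse_onto p w : Start \in w -> wf p w ->
  exists v a, [/\ (size v).+1 = size w, size a = size v, wf p v,
    accepts false v a & fuse (rcons v Start) (rcons a true) = w].
Proof.
elim: w p => //= l w IH p; rewrite inE.
case: (boolP (Start \in w)) => [Sw _|nS].
  move=> wfw.
  have {IH} P p1 (h : wf p1 w) := IH p1 Sw h.
  case: l wfw => [/andP[np /P]|/P|/P] [v [a [s1 s2 h1 h2 h3]]].
  - by exists (Start :: v), (false :: a); split; rewrite /= ?s1 ?s2 ?np ?h3.
  - by exists (Link :: v), (false :: a); split; rewrite /= ?s1 ?s2 ?h3.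
  - by exists (Gap :: v), (false :: a); split; rewrite /= ?s1 ?s2 ?h3.
rewrite orbF => /eqP <- /andP[np /(mark_rcons _ _ nS)[->|[a ->]]].
  by exists [::], [::].
exists (nseq (size a).+1 Start), (true :: a).
split; rewrite ?size_nseq ?size_map ?size_rcons //=.
- by rewrite np wf_nseq_Start.
- exact: accepts_nseq_Start.
Qed.

(** * Counting the well-formed words *)

Fixpoint words (p : bool) (n : nat) : seq (seq letter) :=
  match n with
  | 0 => if p then [::] else [:: [::]]
  | n'.+1 => (if p then [::] else map (cons Start) (words false n'))
      ++ map (cons Link) (words false n') ++ map (cons Gap) (words true n')
  end.

Lemma mem_map_cons (T : eqType) (x y : T) s (ss : seq (seq T)) :
  (x :: s \in map (cons y) ss) = (x == y) && (s \in ss).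
Proof.
apply/mapP/andP=> [[s' ss' [-> ->]]|[/eqP -> sss]]; first by rewrite eqxx.
by exists s.
Qed.

Lemma nil_map_cons (T : eqType) (y : T) (ss : seq (seq T)) :
  ([::] \in map (cons y) ss) = false.
Proof. by apply/mapP=> -[]. Qed.

Lemma mem_words p n w : (w \in words p n) = (size w == n) && wf p w.
Proof.
elim: n p w => [|n IH] p [|l w] //=.
- by case: p.
- by case: p.
- by rewrite !mem_cat !nil_map_cons; case: p; rewrite ?nil_map_cons.
- rewrite !mem_cat !mem_map_cons !IH eqSS.
  by case: p; rewrite ?mem_map_cons ?IH; case: l => //=; rewrite ?orbF ?andbF.
Qed.

Lemma uniq_words p n : uniq (words p n).
Proof.
elim: n p => [|n IH] p; first by case: p.
have consI l : injective (cons l : seq letter -> seq letter) by move=> ? ? [].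
have d (l l' : letter) s s' : l' != l ->
    ~~ has (mem (map (cons l) s)) (map (cons l') s').
  by move=> ll'; apply/hasPn=> _ /mapP[w _ ->];
     rewrite /= mem_map_cons (negbTE ll').
by case: p => /=; rewrite !cat_uniq ?has_cat ?negb_or !(map_inj_uniq (consI _)) !IH ?d //.
Qed.

(** One more letter turns the counts x, y into 2x + y, x + y, which is two Fibonacci steps. *)
Lemma size_words n :
  size (words false n) = fib (2 * n).+1 /\ size (words true n) = fib (2 * n).
Proof.
have fibSS m : fib m.+2 = fib m.+1 + fib m by [].
elim: n => [//|n [IH1 IH2]].
rewrite mulnS add2n !fibSS /= !size_cat !size_map IH1 IH2.
by split; rewrite // addnC.
Qed.

(** * The levels of the state graph *)

Definition vertex (m : nat) (w : seq letter) : {set m.-tuple bool} :=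
  [set b : m.-tuple bool | accepts false w b].

Lemma tval_init m (b : m.+1.-tuple bool) : init b = take m b :> seq bool.
Proof.
apply: (@eq_from_nth _ false) => [|i]; rewrite size_tuple.
  by rewrite size_take size_tuple ltnSn.
move=> im; rewrite nth_take // -[i]/(nat_of_ord (Ordinal im)) -tnth_nth.
by rewrite tnth_mktuple (tnth_nth false).
Qed.

(** Condition (A) is the case [s = m] of compatibility, where the requirement on [a] holds by the
    appended 1. *)
Lemma condABP m (a : m.-tuple bool) (b : m.+1.-tuple bool) :
  reflect (compat (rcons a true) b) (condA a b && condB a b).
Proof.
have aE (i : 'I_m) : nth false (rcons a true) i = tnth a i.
  by rewrite nth_rcons size_tuple ltn_ord (tnth_nth false).
have bE (i : 'I_m) : nth false b i = tnth b (widen i) by rewrite (tnth_nth false).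
have am : nth false (rcons a true) m = true.
  by rewrite nth_rcons size_tuple ltnn eqxx.
have bm : nth false b m = tnth b ord_max by rewrite (tnth_nth false).
apply: (iffP andP) => [[/implyP cA /forallP cB] t s ts bs at_|H].
  have sm : s <= m.
    by rewrite leqNgt; apply/negP=> ms; move: bs; rewrite nth_default ?size_tuple.
  have tm := leq_trans ts sm; pose ot := Ordinal tm.
  move: at_; rewrite -[t]/(nat_of_ord ot) aE bE => at_.
  case: (ltnP s m) => [sm'|ms].
    move: bs; rewrite -[s]/(nat_of_ord (Ordinal sm')) aE bE => bs.
    have /forallP/(_ ot)/implyP := cB (Ordinal sm').
    by apply; rewrite bs ts at_.
  have {ms sm} sE : s = m by apply/eqP; rewrite eqn_leq sm.
  move: bs; rewrite sE am bm andbT => /cA/subsetP/(_ (widen ot)).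
  by rewrite inE; apply; apply: imset_f; rewrite inE.
split.
  apply/implyP=> bl; apply/subsetP=> _ /imsetP[i + ->]; rewrite !inE => ai.
  have := H i m (ltn_ord i); rewrite bm aE bE => /(_ bl ai).
  by case/andP.
apply/forallP=> s; apply/forallP=> t; apply/implyP=> /and3P[bs ts at_].
by have := H t s ts; rewrite !aE !bE; apply.
Qed.

(** Condition (C) is acceptance by [rcons w Start], since a final [Start] leaves the new bit free;
    [accepts_fuse] adds (A) and (B). *)
Lemma M_vertex m w (a : m.-tuple bool) : size w = m -> accepts false w a ->
  M (vertex m w) a = vertex m.+1 (fuse (rcons w Start) (rcons a true)).
Proof.
move=> sw wa; apply/setP=> b; rewrite !inE /condC inE andbA tval_init.
rewrite accepts_take ?sw //.
have [|||] := accepts_fuse false (rcons w Start) (rcons a true) b.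
- by rewrite !size_rcons size_tuple sw.
- by rewrite size_rcons !size_tuple.
- by rewrite accepts_rcons_Start -(accepts_take m) ?sw //
    -cats1 take_size_cat ?size_tuple.
rewrite accepts_rcons_Start => H1 H2.
by apply/andP/idP => [[/condABP ? ?]|/H1[/condABP]]; [apply: H2 | split].
Qed.

Lemma Sigma_recP k (N : {set k.+1.-tuple bool}) :
  reflect (exists2 w, w \in words false k & N = vertex k.+1 (Start :: w))
          (N \in Sigma_rec k).
Proof.
elim: k N => [|k IH] N.
  have v0 : [set [tuple false]; [tuple true]] = vertex 1 [:: Start].
    by apply/setP=> -[[|[] [|? ?]] i]; rewrite !inE.
  rewrite /= inE; apply: (iffP eqP) => [->|[w]].
    by exists [::]; rewrite ?v0.
  by rewrite inE => /eqP -> ->; rewrite v0.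
apply: (iffP imset2P) => [[N' a /IH[w]]|[w]].
  rewrite mem_words => /andP[/eqP sw wfw] -> aN ->.
  move: aN; rewrite inE => wa.
  have sw1 : size (Start :: w) = k.+1 by rewrite /= sw.
  have sa : size (Start :: w) = size a by rewrite size_tuple.
  have wf1 : wf false (Start :: w) by [].
  rewrite (M_vertex _ _ _ sw1 wa); have := wf_fuse _ _ _ sa wa wf1.
  have : size (fuse (rcons (Start :: w) Start) (rcons a true)) = k.+2.
    by rewrite size_fuse ?size_rcons ?sa ?size_tuple.
  set u := fuse _ _; have -> : u = Start :: behead u.
    by rewrite /u; case: (tval a) sa => //= -[].
  by move=> [szu] wfu; exists (behead u); rewrite // mem_words szu eqxx.
rewrite mem_words => /andP[/eqP sw wfw] ->.
have [//|//|v [a [sv sa wfv va mE]]] := fuse_onto false (Start :: w).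
move: sv; rewrite /= sw => -[sv].
have sza : size a == k.+1 by rewrite sa sv.
case: v sv sa wfv va mE => [|l v] sv sa wfv va mE; first by [].
(* If [a] begins with 0, fusion keeps [l], and the fused word begins with [Start]; if it begins with
   1, acceptance under the flag [false] rules out [Link] and [Gap]. *)
have lS : l = Start.
  by case: a mE sa va {sza} => // -[] a /= [] //; case: l {wfv sv}.
rewrite {l}lS in sv sa wfv va mE.
exists (vertex k.+1 (Start :: v)) (Tuple sza).
- by apply/IH; exists v; rewrite // mem_words [wf _ _]wfv andbT; case: sv => ->.
- by rewrite inE.
- by rewrite M_vertex // mE.
Qed.

Lemma vertex_inj k w w' : size w = k -> size w' = k ->
  vertex k.+1 (Start :: w) = vertex k.+1 (Start :: w') -> w = w'.
Proof.
move=> sw sw' /setP H; apply: accepts_inj => [|f b sb]; first by rewrite sw sw'.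
have sz : size (f :: b) == k.+1 by rewrite /= sb sw.
by have := H (Tuple sz); rewrite !inE.
Qed.

Lemma card_Sigma_rec k : #|Sigma_rec k| = G k.
Proof.
pose vs := [seq vertex k.+1 (Start :: w) | w <- words false k].
have -> : #|Sigma_rec k| = #|vs|.
  apply: eq_card => N; apply/Sigma_recP/mapP => -[w wk ->]; by exists w.
rewrite (card_uniqP _) ?size_map; first by have [] := size_words k.
rewrite map_inj_in_uniq ?uniq_words // => w w'.
by rewrite !mem_words => /andP[/eqP sw _] /andP[/eqP sw' _]; apply: vertex_inj.
Qed.

Theorem theorem12 (n : int) (hn : (-1 <= n)%R) :
  #|Sigma n| = G (absz (n + 1)%R).
Proof. exact: card_Sigma_rec. Qed.
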